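(* Let $a\ge 3$ be an odd integer, let $D$ be a difference matrix DM$(3;a)$ in standard form, and let $H$ be the $(4a)\times a^2$ binary matrix built from $D$ by Construction 1. Then $H$ is a parity-check matrix of an $(a^2,4,a)$-regular binary LDPC code that satisfies the RC-constraint.
   Context: All rows and columns of matrices are indexed starting from $0$. Difference matrix: a DM$(3;a)$ is an $a\times 3$ array $D=[D(i,j)]$, $0\le i\le a-1$, $0\le j\le 2$, with entries in $\{0,\dots,a-1\}$, such that (1) all entries of the first column ($j=0$) are $0$ and each of the other columns contains each of $0,\dots,a-1$ exactly once; (2) for all pairs of distinct columns $j\ne j'$, $\{D(i,j)-D(i,j') \bmod a \mid 0\le i\le a-1\}=\{0,\dots,a-1\}$. It is in standard form if $D(i,1)=i$ for all $i$. Construction 1: let $I$ be the $a\times a$ identity matrix, and let $P^i$ be the $a\times a$ $(0,1)$ circulant permutation matrix whose row $r$ has its unique entry $1$ in column $r-i \bmod a$ (so $P^0=I$). For $0\le v\le a-1$ let $R_v$ be the $a\times a$ matrix whose row $v$ is all ones and whose other rows are all zeros. Then $$H=\begin{bmatrix} R_0&R_1&\cdots&R_{a-1}\\ I&I&\cdots&I\\ P^{D(0,1)}&P^{D(1,1)}&\cdots&P^{D(a-1,1)}\\ P^{D(0,2)}&P^{D(1,2)}&\cdots&P^{D(a-1,2)}\end{bmatrix}.$$ An $(m,w_c,w_r)$-regular binary LDPC code is the null space over $\mathbb{Z}_2$ of a (sparse) $(0,1)$ matrix with $m$ columns, all of whose columns have exactly $w_c$ ones and all of whose rows have exactly $w_r$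 ones (this matrix is its parity-check matrix; ''sparse'' is informal). A parity-check matrix satisfies the RC-constraint if the inner product (over the integers) of any two distinct rows is at most $1$ and that of any two distinct columns is at most $1$. *)

(* Defs.v *)
From HB Require Import structures.
From mathcomp Require Import all_boot all_order all_algebra.

Set Implicit Arguments.
Unset Strict Implicit.
Unset Printing Implicit Defensive.

Import Order.TTheory GRing.Theory Num.Theory.
Local Open Scope ring_scope.

(* DM(3; a): differences are taken in [int], not with truncated subtraction. *)
Definition difference_matrix (a : nat) (D : 'M['I_a]_(a, 3)) : Prop :=
  [/\ forall i : 'I_a, D i 0 = 0%N :> nat,
      forall (j : 'I_3) (x : 'I_a), j != 0 -> exists! i : 'I_a, D i j = x
    & forall (j j' : 'I_3) (x : int), j != j' ->
        (exists i : 'I_a, (((D i j)%:Z - (D i j')%:Z) %% a%:Z)%Z = x)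
        <-> 0 <= x < a%:Z].

Definition standard_form (a : nat) (D : 'M['I_a]_(a, 3)) : Prop :=
  forall i : 'I_a, D i 1 = i.

(* (0,1) matrices are integer matrices, so that inner products of rows and
   columns are computed over the integers. *)

(* P^i *)
Definition circulant_perm (a i : nat) : 'M[int]_a :=
  \matrix_(r < a, c < a) (c%:Z == ((r%:Z - i%:Z) %% a%:Z)%Z)%:R.

(* R_v *)
Definition ones_row (a : nat) (v : 'I_a) : 'M[int]_a :=
  \matrix_(r < a, c < a) (r == v)%:R.

Definition H_block (a : nat) (D : 'M['I_a]_(a, 3)) (k : 'I_4) (v : 'I_a) :
    'M[int]_a :=
  nth 0 [:: ones_row v; 1%:M; circulant_perm a (D v 1); circulant_perm a (D v 2)]
    k.

Fact H_rows (a : nat) : (\sum_(k < 4) a = 4 * a)%N.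
Proof. by rewrite sum_nat_const card_ord. Qed.

Fact H_cols (a : nat) : (\sum_(v < a) a = a ^ 2)%N.
Proof. by rewrite sum_nat_const card_ord. Qed.

(* The cast only rewrites the dimensions of the block matrix. *)
Definition construction1 (a : nat) (D : 'M['I_a]_(a, 3)) :
    'M[int]_(4 * a, a ^ 2) :=
  castmx (H_rows a, H_cols a) (\mxblock_(k < 4, v < a) H_block D k v).

Definition null_space_F2 (k m : nat) (H : 'M[int]_(k, m)) :
    {set 'cV['F_2]_m} :=
  [set x : 'cV['F_2]_m | map_mx intr H *m x == 0].

(* C is the (m, wc, wr)-regular binary LDPC code with parity-check matrix H;
   sparsity, being informal, is not part of the definition. *)
Definition regular_LDPC_parity_check (m wc wr : nat) (C : {set 'cV['F_2]_m})
    (k : nat) (H : 'M[int]_(k, m)) : Prop :=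
  [/\ forall i j, H i j = 0 \/ H i j = 1,
      forall j, #|[set i | H i j == 1]| = wc,
      forall i, #|[set j | H i j == 1]| = wr
    & C = null_space_F2 H].
Arguments regular_LDPC_parity_check m wc wr C {k} H.

Definition RC_constraint (k m : nat) (H : 'M[int]_(k, m)) : Prop :=
  (forall i i' : 'I_k, i != i' -> \sum_(j < m) H i j * H i' j <= 1)
  /\ (forall j j' : 'I_m, j != j' -> \sum_(i < k) H i j * H i j' <= 1).

(* Main.v *)
Require Import Defs.
From mathcomp Require Import all_boot all_order all_algebra ring.

(** Read a column [(v, c)] of [H] (column [c] of the [v]-th block column) as a
    point and a row [(k, r)] (row [r] of the [k]-th block row) as a line.  Each
    point lies on exactly one line of each of the four classes [k]: the one
    with index [v] for [k = 0], and the one with index [c + D(v, j)] mod [a]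
    for [k = j + 1] (for [j = 0] this is the block row of identity matrices,
    since the first column of [D] is zero).  So [H] is the incidence matrix of
    a net, and everything follows from one property: two lines of different
    classes have at most one common point.  For a line [v] and a line of a
    class [j + 1] that holds because translations are injective.  For classes
    [j + 1] and [j' + 1], two common points [(v, c)] and [(v', c')] satisfy
    [D(v, j) - D(v, j') = D(v', j) - D(v', j')] mod [a], whence [v = v'], as the
    differences of two columns of [D] take all [a] residues and therefore each
    of them once; then [c = c'].

    The property bounds the inner product of rows of different classes, while
    lines of one class are disjoint.  It also says that two distinct points
    agree in at most one class, which is the bound for columns.  Finally, by
    counting ([a ^ 2] points and [a ^ 2] pairs of lines), two lines of
    different classes meet exactly once, so that a line carries as many points
    as there are lines in any other class, namely [a]. *)

Set Implicit Arguments.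
Unset Strict Implicit.
Unset Printing Implicit Defensive.

Import Order.TTheory GRing.Theory Num.Theory.
Local Open Scope ring_scope.

(** * Nets: families of partitions into lines that meet at most once *)

(** A class of parallel lines is encoded by the function [phi k] that maps each
    point to the index of its line. *)
Definition net (K P G : finType) (phi : K -> P -> G) : Prop :=
  forall k k', k != k' -> injective (fun p => (phi k p, phi k' p)).

Lemma card_lines_through (K P G : finType) (phi : K -> P -> G) (p : P) :
  #|[set l : K * G | phi l.1 p == l.2]| = #|K|.
Proof.
have inj : injective (fun k => (k, phi k p)) by move=> k k' [].
rewrite -(card_imset _ inj); apply: eq_card => -[k r]; rewrite inE /=.
apply/eqP/imsetP => [<-|[k' _ [-> ->]]] //.
by exists k; rewrite ?inE.
Qed.

(** With [#|G| ^ 2] points the pair of lines of classes [k] and [k'] determines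
    and is determined by the point, so the points of a line of class [k]
    correspond to the lines of class [k']. *)
Lemma card_points_on (K P G : finType) (phi : K -> P -> G) (k k' : K) (r : G) :
    net phi -> #|P| = (#|G| * #|G|)%N -> k != k' ->
  #|[set p | phi k p == r]| = #|G|.
Proof.
move=> netphi cardP nekk'.
have pair_bij : bijective (fun p => (phi k p, phi k' p)).
  by apply: inj_card_bij; [exact: netphi | rewrite card_prod cardP].
have -> : [set p | phi k p == r] =
    (fun p => (phi k p, phi k' p)) @^-1: setX [set r] [set: G].
  by apply/setP => p; rewrite !inE andbT.
by rewrite on_card_preimset ?cardsX ?cards1 ?mul1n ?cardsT //; apply: onW_bij.
Qed.

Lemma card_common_points (K P G : finType) (phi : K -> P -> G) (l l' : K * G) :
    net phi -> l != l' ->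
  (#|[set p | (phi l.1 p == l.2) && (phi l'.1 p == l'.2)]| <= 1)%N.
Proof.
case: l l' => [k r] [k' r'] netphi nell' /=.
apply/card_le1_eqP => p q; rewrite !inE.
move=> /andP[/eqP pr /eqP pr'] /andP[/eqP qr /eqP qr'].
have [eqkk'|nekk'] := eqVneq k k'.
  by case/eqP: nell'; rewrite -pr -pr' eqkk'.
by apply: (netphi _ _ nekk'); rewrite /= pr pr' qr qr'.
Qed.

Lemma card_common_lines (K P G : finType) (phi : K -> P -> G) (p p' : P) :
    net phi -> p != p' ->
  (#|[set l : K * G | (phi l.1 p == l.2) && (phi l.1 p' == l.2)]| <= 1)%N.
Proof.
move=> netphi nepp'; apply/card_le1_eqP => -[k r] [k' r']; rewrite !inE /=.
move=> /andP[/eqP pr /eqP p'r] /andP[/eqP pr' /eqP p'r'].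
have [eqkk'|nekk'] := eqVneq k k'; first by rewrite -pr -pr' eqkk'.
by case/eqP: nepp'; apply: (netphi _ _ nekk'); rewrite /= pr p'r pr' p'r'.
Qed.

(** * Incidence matrices *)

Lemma card_preim_bij (T S : finType) (f : T -> S) (A : pred S) :
  bijective f -> #|[set x | A (f x)]| = #|[set y | A y]|.
Proof.
move=> bijf; rewrite -(on_card_preimset (onW_bij _ bijf)).
by apply: eq_card => x; rewrite !inE.
Qed.

Lemma sum_indicatorM (T : finType) (A B : pred T) :
  \sum_(x : T) (A x)%:R * (B x)%:R = #|[set x | A x && B x]|%:R :> int.
Proof.
rewrite -sum1_card natr_sum [RHS]big_mkcond /=; apply: eq_bigr => x _.
by rewrite inE; case: (A x); case: (B x).
Qed.

Section IncidenceMatrix.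

Context (K P G : finType) (phi : K -> P -> G) (k m : nat) (H : 'M[int]_(k, m)).
Context (line_of : 'I_k -> K * G) (point_of : 'I_m -> P).
Hypothesis bij_line : bijective line_of.
Hypothesis bij_point : bijective point_of.
Hypothesis HE :
  forall i j, H i j = (phi (line_of i).1 (point_of j) == (line_of i).2)%:R.

Lemma incidence_eq1 i j :
  (H i j == 1) = (phi (line_of i).1 (point_of j) == (line_of i).2).
Proof. by rewrite HE; case: (phi _ _ == _). Qed.

Lemma incidence_regular (netphi : net phi) :
    #|P| = (#|G| * #|G|)%N -> (1 < #|K|)%N ->
  regular_LDPC_parity_check m #|K| #|G| (null_space_F2 H) H.
Proof.
move=> cardP /card_gt1P[k0 [k1 [_ _ ne01]]]; split => // [i j|j|i].
- by rewrite HE; case: (_ == _); [right | left].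
- rewrite (eq_finset _ (incidence_eq1^~ j)).
  by rewrite (card_preim_bij (fun l => phi l.1 _ == l.2)) ?card_lines_through.
rewrite (eq_finset _ (incidence_eq1 i)).
rewrite (card_preim_bij (fun p => phi _ p == _)) //.
have [eq0|ne0] := eqVneq (line_of i).1 k0.
  by apply: (card_points_on (k' := k1)); rewrite ?eq0.
exact: card_points_on ne0.
Qed.

Lemma incidence_RC : net phi -> RC_constraint H.
Proof.
move=> netphi; split=> [i i' neii'|j j' nejj'].
  under eq_bigr do rewrite !HE.
  rewrite sum_indicatorM (card_preim_bij
    (fun p => (phi _ p == (line_of i).2) && (phi _ p == (line_of i').2))) //.
  by rewrite (ler_nat _ _ 1) card_common_points // (bij_eq bij_line).
under eq_bigr do rewrite !HE.
rewrite sum_indicatorM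
  (card_preim_bij (fun l => (phi l.1 _ == l.2) && (phi l.1 _ == l.2))) //.
by rewrite (ler_nat _ _ 1) card_common_lines // (bij_eq bij_point).
Qed.

End IncidenceMatrix.

(** * The net of a difference matrix *)

Definition translate (a : nat) (c d : 'I_a) : 'I_a :=
  Ordinal (ltn_pmod (c + d) (leq_ltn_trans (leq0n c) (ltn_ord c))).

(** For [k = j + 1] the [k]-th block row consists of the circulants given by
    column [j] of [D]; the identity matrices are those of the zero column. *)
Definition line_through (a : nat) (D : 'M['I_a]_(a, 3)) (k : 'I_4)
    (p : 'I_a * 'I_a) : 'I_a :=
  if unlift ord0 k is Some j then translate p.2 (D p.1 j) else p.1.

Lemma translate_modz (a : nat) (c d : 'I_a) :
  (translate c d)%:Z = ((c%:Z + d%:Z) %% a%:Z)%Z.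
Proof. by rewrite /= -modz_nat PoszD. Qed.

Lemma modz_ord (a : nat) (c : 'I_a) : (c%:Z %% a%:Z)%Z = c%:Z.
Proof. by rewrite modz_nat modn_small. Qed.

Lemma translate_injl (a : nat) (d : 'I_a) : injective (fun c => translate c d).
Proof.
move=> c c' /(congr1 (fun x : 'I_a => x%:Z)); rewrite !translate_modz.
move/eqP; rewrite eqz_modDr => /eqP; rewrite !modz_ord => -[eqcc'].
exact: val_inj.
Qed.

Lemma circulant_permE (a : nat) (d r c : 'I_a) :
  circulant_perm a d r c = (translate c d == r)%:R.
Proof.
rewrite mxE -(inj_eq val_inj) -(inj_eq (can_inj absz_nat)); congr (_%:R).
rewrite translate_modz -{1}(modz_ord c) -{2}(modz_ord r).
by rewrite -(eqz_modDr d%:Z c%:Z (r%:Z - d%:Z)) subrK.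
Qed.

(** A surjection between sets of the same size is injective; here the residues
    mod [a] are represented by ['I_a]. *)
Lemma diff_inj (a : nat) (D : 'M['I_a]_(a, 3)) (j j' : 'I_3) (v v' : 'I_a) :
    difference_matrix D -> j != j' ->
    ((D v j)%:Z - (D v j')%:Z = (D v' j)%:Z - (D v' j')%:Z %[mod a%:Z])%Z ->
  v = v'.
Proof.
case=> _ _ diffD nejj'.
pose delta w := (((D w j)%:Z - (D w j')%:Z) %% a%:Z)%Z.
have delta_onto (x : 'I_a) : exists w, delta w == x%:Z.
  have [_ [|w <-]] := diffD j j' x%:Z nejj'.
    by rewrite lez_nat ltz_nat ltn_ord.
  by exists w.
(* [g] is a section of [delta], hence injective, hence onto ['I_a]. *)
pose g x := xchoose (delta_onto x).
have gK x : delta (g x) = x%:Z by apply/eqP/(xchooseP (delta_onto x)).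
have g_inj : injective g.
  move=> x y eqg; apply: val_inj; have := gK x.
  by rewrite eqg gK => -[].
have [h _ hK] := injF_bij g_inj.
move=> eqd; have := gK (h v); rewrite hK {1}/delta eqd -/(delta v').
by rewrite -{1}(hK v') gK => -[/val_inj/(congr1 g)]; rewrite !hK.
Qed.

(** Two equalities [c + D(v, i) = c' + D(v', i)], for [i = j] and [i = j'], are
    subtracted to eliminate [c] and [c']. *)
Lemma line_through_net (a : nat) (D : 'M['I_a]_(a, 3)) :
  difference_matrix D -> net (line_through D).
Proof.
move=> dmD k k' nekk' [v c] [v' c'].
rewrite /line_through /=.
case: unliftP => [j|] ek; case: unliftP => [j'|] ek'; last first.
- by rewrite ek ek' eqxx in nekk'.
- case=> <- e; congr (_, _).
  exact/(@translate_injl _ (D v j'))/val_inj.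
- move=> [+ eqv]; rewrite -eqv => e; congr (_, _).
  exact/(@translate_injl _ (D v j))/val_inj.
have nejj' : j != j' by apply: contraNneq nekk' => e; rewrite ek ek' e.
move=> [/(congr1 Posz) ej /(congr1 Posz) ej'].
have eqv : v = v'.
  apply: (diff_inj dmD nejj'); apply/eqP.
  move: ej ej'; rewrite /= -!modz_nat !PoszD => /eqP + /eqP.
  rewrite !eqz_mod_dvd => dj dj'; rewrite (_ : _ - _ =
    (c%:Z + (D v j)%:Z - (c'%:Z + (D v' j)%:Z)) -
    (c%:Z + (D v j')%:Z - (c'%:Z + (D v' j')%:Z))); last by ring.
  exact: rpredB.
rewrite -eqv in ej *; case: ej => ej; congr (_, _).
exact/(@translate_injl _ (D v j))/val_inj.
Qed.

(** * Indices of a block matrix *)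

Definition block_index (n a N : nat) (e : (\sum_(k < n) a)%N = N) (i : 'I_N) :
    'I_n * 'I_a :=
  let s := cast_ord (esym e) i in (tagnat.sig1 s, tagnat.sig2 s).

Lemma block_index_bij (n a N : nat) (e : (\sum_(k < n) a)%N = N) :
  bijective (block_index e).
Proof.
apply: inj_card_bij; last first.
  by rewrite card_prod !card_ord -e sum_nat_const card_ord.
move=> i i' [e1 e2]; apply: (@cast_ord_inj _ _ (esym e)); apply: tagnat.sig_inj.
move: e1 e2; rewrite /tagnat.sig2 /tagnat.sig1.
case: (tagnat.sig _) => k r; case: (tagnat.sig _) => k' r' /=.
by move=> -> ->.
Qed.

Lemma H_blockE (a : nat) (D : 'M['I_a]_(a, 3)) (k : 'I_4) (v r c : 'I_a) :
    difference_matrix D ->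
  H_block D k v r c = (line_through D k (v, c) == r)%:R.
Proof.
case=> D0 _ _; rewrite /line_through /H_block.
case: unliftP => [j|] -> /=; last by rewrite mxE eq_sym.
case: j => [[|[|[|//]]] lt_j] /=.
- have -> : Ordinal lt_j = 0 by apply: val_inj.
  rewrite mxE eq_sym; congr (_ == r)%:R; apply: val_inj.
  by rewrite /= D0 addn0 modn_small.
- rewrite circulant_permE.
  by congr (translate _ (D _ _) == _)%:R; apply: val_inj.
rewrite circulant_permE.
by congr (translate _ (D _ _) == _)%:R; apply: val_inj.
Qed.

Lemma construction1E (a : nat) (D : 'M['I_a]_(a, 3)) i j :
    difference_matrix D ->
  construction1 D i j =
    (line_through D (block_index (H_rows a) i).1 (block_index (H_cols a) j)
      == (block_index (H_rows a) i).2)%:R.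
Proof. by move=> dmD; rewrite castmxE mxE H_blockE. Qed.

(* The theorem compares and exponentiates natural numbers. *)
Local Close Scope ring_scope.

Theorem lemma3 (a : nat) (D : 'M['I_a]_(a, 3)) (ha : 3 <= a) (odd_a : odd a)
    (dmD : difference_matrix D) (stdD : standard_form D) :
  exists C : {set 'cV['F_2]_(a ^ 2)},
    regular_LDPC_parity_check (a ^ 2) 4 a C (construction1 D)
    /\ RC_constraint (construction1 D).
Proof.
exists (null_space_F2 (construction1 D)).
have netD := line_through_net dmD.
have HE i j := construction1E i j dmD.
have bij_row := block_index_bij (H_rows a).
have bij_col := block_index_bij (H_cols a).
split; last exact: (incidence_RC bij_row bij_col HE netD).
have := incidence_regular bij_row bij_col HE netD.
by rewrite card_prod !card_ord; apply.
Qed.
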